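(* Let $r,n\ge1$. The map $\mathsf{M}_F$, from the set of $r$-fans of Dyck paths of length $n$ to the set of $n\times n$ matrices with nonnegative integer entries, is injective.
   Context: Partitions with at most $r$ parts are identified with weakly decreasing $r$-tuples of nonnegative integers; $\emptyset=(0,\dots,0)$. For $x\in\mathbb{Z}^r$, $\mathrm{dom}(x)$ is obtained by sorting $|x_1|,\dots,|x_r|$ into weakly decreasing order. An $r$-fan of Dyck paths of length $n$ is a sequence $\mathsf{F}=(\emptyset=\mu^0,\mu^1,\dots,\mu^n=\emptyset)$ of partitions with at most $r$ parts such that each $\mu^{i+1}-\mu^i$ lies in $\{\pm1\}^r$. Promotion: for $T=(\emptyset=\mu^0,\dots,\mu^n=\emptyset)$ let $\mathsf{pr}(T)=(\hat\mu^0,\dots,\hat\mu^n)$ with $\hat\mu^0=\emptyset$, $\hat\mu^j=\mathrm{dom}(\hat\mu^{j-1}+\mu^{j+1}-\mu^j)$ for $1\le j\le n-1$, $\hat\mu^n=\emptyset$. Let $T_i=\mathsf{pr}^i(\mathsf{F})=(T_i^0,\dots,T_i^n)$. $\mathsf{M}_F(\mathsf{F})=(m_{i,j})_{1\le i,j\le n}$ has $m_{i,i}=0$, and for $1\le i\le n$, $1\le d\le n-1$, $j\in\{1,\dots,n\}$ with $j\equiv i+d\pmod n$, $m_{i,j}$ is the number of negative entries of $T_i^{d-1}+T_{i-1}^{d+1}-T_{i-1}^d$. *)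

(* Defs.v *)
From HB Require Import structures.
From mathcomp Require Import all_boot all_order all_algebra.

Set Implicit Arguments.
Unset Strict Implicit.
Unset Printing Implicit Defensive.

Import Order.TTheory GRing.Theory Num.Theory.
Local Open Scope ring_scope.

Section Fans.

Variable r : nat.

Definition is_partition (x : 'rV[int]_r) : bool :=
  [forall k : 'I_r, 0 <= x ord0 k] &&
  [forall k : 'I_r, forall l : 'I_r, (k <= l)%N ==> (x ord0 l <= x ord0 k)].

Definition dom (x : 'rV[int]_r) : 'rV[int]_r :=
  \row_(k < r) (sort >=%O [seq `|x ord0 l| | l <- enum 'I_r])`_k.

Definition num_neg (x : 'rV[int]_r) : nat := #|[set k : 'I_r | x ord0 k < 0]|.

(* The sequence (mu^0, ..., mu^n) is the (n+1)-tuple T with T`_j = mu^j. *)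
Definition is_fan (n : nat) (T : n.+1.-tuple 'rV[int]_r) : bool :=
  [&& T`_0 == 0, T`_n == 0,
      all is_partition T
    & [forall j : 'I_n, forall k : 'I_r,
         (T`_j.+1 - T`_j) ord0 k \in [:: 1; -1]]].

Fixpoint pr_aux (mu : nat -> 'rV[int]_r) (j : nat) : 'rV[int]_r :=
  if j is j'.+1 then dom (pr_aux mu j' + mu j.+1 - mu j) else 0.

Definition pr (n : nat) (T : n.+1.-tuple 'rV[int]_r) : n.+1.-tuple 'rV[int]_r :=
  [tuple if j == n :> nat then 0 else pr_aux (nth 0 T) j | j < n.+1].

(* Indices are 0-based: the entry at (i, j) is m_{i+1,j+1}, so it compares
   T_{i+1} with T_i, and d is the representative of j - i mod n in 1, ..., n-1. *)
Definition M_F (n : nat) (F : n.+1.-tuple 'rV[int]_r) : 'M[nat]_n :=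
  \matrix_(i < n, j < n)
    if i == j then 0%N else
      let d := ((j + n - i) %% n)%N in
      let T := iter i (@pr n) F in
      let T' := pr T in
      num_neg (T'`_d.-1 + T`_d.+1 - T`_d).

End Fans.

(* Main.v *)
Require Import Defs.
From mathcomp Require Import all_boot all_order all_algebra.
From mathcomp Require Import zify.

(* Encode a partition by its levels lev x t = #{k : t <= x_k}.  Think of F as
   the staircase boundary of a growth diagram with filling M: the shape at
   position j is built from the rows <= j and the columns > j.  Removing the
   outermost row of such a diagram is a reversible operation [del] on its
   boundary, which is the walk mu^0 > kappa^1 < mu^1 > ... where
   kappa^j = min (mu^(j-1), mu^j); going back only requires the entries of the
   removed row.  Removing the first row from F gives the same walk as removing
   the last column from pr F, and the removed row consists of the numbers of
   negative entries in the definition of M_F.  Since removing an outer row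
   commutes with removing an outer column (a cube of local rules), the rows
   obtained by iterating [del] on F are the upper triangular parts of the rows
   of M_F F, and F is recovered from them starting from the empty walk. *)

Set Implicit Arguments.
Unset Strict Implicit.
Unset Printing Implicit Defensive.

Import Order.TTheory GRing.Theory Num.Theory.

(* Local rules of growth diagrams, in terms of levels.  In a square [l m n p]
   the shape [l] is the largest, [p] the smallest, and each step is a vertical
   strip.  The level 0 of a shape is the bound r on its number of parts. *)
Definition strip (x y : nat -> nat) :=
  x 0 = y 0 /\ forall t, x t <= y t /\ y t.+1 <= x t.

(* Two rows, or two columns: [n] is the sort of [p + l - m]. *)
Definition jdt (l m n p : nat -> nat) := forall t,
  m t.+1 + n t.+1 = minn (p t) (l t.+1) + maxn (p t.+1) (l t.+2).

(* The outermost row and the innermost column, or conversely: [p] is the sort of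
   the positive part of [m + n - l].  The entry of the cell is the number of
   negative parts, [l 1 - maxn (m 1) (n 1)]. *)
Definition rsk (l m n p : nat -> nat) := forall t,
  l t.+2 + p t.+1 = maxn (m t.+2) (n t.+2) + minn (m t.+1) (n t.+1).

(* The outermost row and the outermost column: the entry of the cell is the
   limit of the carry [c], which the levels absorb from high to low. *)
Definition burge (l m n p c : nat -> nat) := c 0 = 0 /\ forall t,
  c t + l t.+1 + p t.+1 = c t.+1 + m t.+1 + n t.+1 /\ l t.+1 <= p t /\
  (c t = 0 \/ l t.+1 = p t).

(** * Cubes of local rules *)

(* Primed shapes have one inner column less; [m] and [p] lack the outermost row,
   [n] and [p] lack the outermost column. *)
Section RemoveColumn.

Variables (l m n p l' n' c : nat -> nat).
Hypotheses (ml : strip m l) (nl : strip n l) (pm : strip p m) (pn : strip p n).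
Hypotheses (l'l : strip l' l) (n'n : strip n' n) (n'l' : strip n' l').
Hypothesis Bp : burge l m n p c.
Hypothesis Jn : jdt l l' n n'.

(** The carry of the primed square. Subtracting the two [rsk] faces moves every level down by one,
    hence [c t.+1]; written with truncated differences, their maxima and minima leave corrections
    that telescope. *)
Definition next_carry t :=
  c t.+1 + (n' t.+1 - p t.+1) - (l' t.+1 - m t.+1).

(** The outer subtraction in [next_carry] is never truncated. By [Jn] and [l t.+2 <= p t.+1],
    [l' t.+1 + n t.+1] is at most [l t.+1 + maxn (n' t.+1) (p t.+1)]; the [burge] equation does the
    rest. *)
Lemma next_carry_ge0 t :
  l' t.+1 - m t.+1 <= c t.+1 + (n' t.+1 - p t.+1).
Proof.
have := Jn t; have := Bp.2 t; have := Bp.2 t.+1; have := Bp.1.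
have := ml.2 t; have := nl.2 t; have := pm.2 t; have := pn.2 t.
have := l'l.2 t; have := n'n.2 t; have := n'l'.2 t.
have := ml.2 t.+1; have := nl.2 t.+1; have := pm.2 t.+1; have := pn.2 t.+1.
have := l'l.2 t.+1; have := n'n.2 t.+1; have := n'l'.2 t.+1.
by lia.
Qed.

Lemma next_carry0 : next_carry 0 = 0.
Proof.
have := Jn 0; have := Bp.2 0; have := Bp.2 1; have := Bp.1.
have := l'l.1; have := n'l'.1; have := pm.1; have := ml.1; have := n'n.1.
have := nl.1.
have := ml.2 0; have := l'l.2 0; have := n'l'.2 0; have := pm.2 0.
have := ml.2 1; have := nl.2 1; have := pm.2 1; have := pn.2 1.
have := l'l.2 1; have := n'n.2 1; have := n'l'.2 1.
by rewrite /next_carry; lia.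
Qed.

(** This is [next_carry 0 = 0] rearranged. It makes the entries of the two [rsk] faces agree, so
    removing the outermost column does not affect the entry of the outermost row in the innermost
    column. *)
Lemma remove_column_entry :
  l 1 + maxn (n' 1) (p 1) = n 1 + maxn (l' 1) (m 1).
Proof.
have := next_carry0; rewrite /next_carry; have := next_carry_ge0 0.
have := Bp.2 0; have := Bp.1.
by have := ml.2 1; have := nl.2 1; have := pm.2 1; lia.
Qed.

Variables (m' p' : nat -> nat).
Hypothesis p'p : strip p' p.
Hypothesis Rm : rsk l l' m m'.
Hypothesis Rp : rsk n n' p p'.

(** For [t > 0], [Rp] gives [p' t + A = minn (n' t) (p t)], while [Jn] turns the difference on the
    right into [minn (n' t) (l t.+1)]. If [p t] and [l t.+1] differ then [c t = 0], and both are at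
    least [m t.+1 + A]. *)
Lemma min_bottom t (A := n t.+1 - maxn (n' t.+1) (p t.+1)) :
  minn (p' t) (m t.+1) + A =
  minn (l' t.+1 + n t.+1 - maxn (n' t.+1) (l t.+2)) (m t.+1 + A).
Proof.
rewrite {}/A.
have := Jn t; have := Bp.2 t; have := ml.2 t; have := l'l.2 t; have := n'n.2 t.
have := pn.2 t; have := nl.2 t; have := pm.2 t; have := n'l'.2 t.
have := nl.2 t.+1; have := pn.2 t.+1; have := n'n.2 t.+1; have := ml.2 t.+1.
have := n'l'.2 t.+1.
case: t => [|t].
  have := p'p.1; have := pn.1; have := n'n.1; have := nl.1; have := l'l.1.
  by have := Bp.1; have := ml.1; lia.
by have := Rp t; have := Bp.2 t.+1; lia.
Qed.

(** By [Jn], [l' t.+2 + n t.+2] is [M + maxn (n' t.+2) (l t.+3)], and [l t.+3 <= p t.+2] is absorbed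
    by the other maximum. Together with [min_bottom] this eliminates [p'] from the bottom [jdt]
    face. *)
Lemma max_bottom t (M := minn (n' t.+1) (l t.+2)) :
  p' t.+1 + n t.+2 + M =
  maxn (l' t.+2 + n t.+2) (p t.+2 + M) + minn (n' t.+1) (p t.+1).
Proof.
by rewrite {}/M; have := Jn t.+1; have := Rp t; have := Bp.2 t.+2; lia.
Qed.

Lemma carry_bound t :
  c t.+1 = 0 \/ p t.+1 + minn (n' t) (l t.+1) <= l' t.+1 + n t.+1.
Proof. by have := Jn t; have := Bp.2 t.+1; lia. Qed.

Lemma remove_column_jdt : jdt m m' p p'.
Proof.
move=> t; have := Rm t; have := min_bottom t; have := max_bottom t.
have := ml.2 t; have := nl.2 t; have := pm.2 t; have := pn.2 t.
have := l'l.2 t; have := n'n.2 t; have := n'l'.2 t.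
have := ml.2 t.+1; have := nl.2 t.+1; have := pm.2 t.+1; have := pn.2 t.+1.
have := l'l.2 t.+1; have := n'n.2 t.+1; have := n'l'.2 t.+1.
have := Bp.2 t; have := Bp.2 t.+1; have := carry_bound t.+1.
have : l' t.+1 + n t.+1 <= l t.+1 + maxn (n' t.+1) (l t.+2).
  by have := Jn t; lia.
case: (leqP (n' t.+1) (l t.+2)) => ?; case: (leqP (n' t.+1) (p t.+1)) => ?;
  case: (leqP (l' t.+2) (m t.+2)) => ?; case: (leqP (l' t.+1) (m t.+1)) => ?.
all: lia.
Qed.

Lemma remove_column_burge : burge l' m' n' p' next_carry.
Proof.
split=> [|t]; first exact: next_carry0.
split; last first.
  case: t => [|t].
    split; last by left; exact: next_carry0.
    have := p'p.1; have := pn.1; have := nl.1.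
    by have := l'l.2 1; have := nl.2 0; lia.
  (* [Jn] and [Rp] write [l' t.+2 + n t.+2] and [p' t.+1 + n t.+2] as a minimum plus a maximum, with
     levels of [l] in one and of [p] one index lower in the other. The terms are compared one by
     one; a positive carry forces equality in each. *)
  have minS : minn (n' t.+1) (l t.+2) <= minn (n' t.+1) (p t.+1).
    by have := Bp.2 t.+1; lia.
  have maxS : maxn (n' t.+2) (l t.+3) <= maxn (n' t.+2) (p t.+2).
    by have := Bp.2 t.+2; lia.
  split; first by have := Rp t; have := Jn t.+1; lia.
  case: (posnP (next_carry t.+1)) => [->|pos]; [by left | right].
  have maxE : maxn (n' t.+2) (p t.+2) = maxn (n' t.+2) (l t.+3).
    by move: pos; rewrite /next_carry; have := Bp.2 t.+2; lia.
  have minE : minn (n' t.+1) (p t.+1) = minn (n' t.+1) (l t.+2).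
    have := Bp.2 t.+1; have := Jn t.+1; rewrite -maxE.
    move: pos; rewrite /next_carry.
    by case: (leqP (n' t.+2) (p t.+2)) => ?; lia.
  by have := Rp t; have := Jn t.+1; lia.
have := next_carry_ge0 t; have := next_carry_ge0 t.+1.
have := Rp t; have := Rm t; have := Bp.2 t.+1; rewrite /next_carry.
case: (leqP (n' t.+2) (p t.+2)) => ?; case: (leqP (n' t.+1) (p t.+1)) => ?;
  case: (leqP (l' t.+2) (m t.+2)) => ?; case: (leqP (l' t.+1) (m t.+1)) => ?.
all: lia.
Qed.

End RemoveColumn.

(** * Completing squares from three shapes *)

Lemma burgeC l m n p c : burge l m n p c -> burge l n m p c.
Proof. by case=> c0 B; split=> // t; have := B t; lia. Qed.

Lemma burge_strip l m n p c :
  burge l m n p c -> strip m l -> strip n l -> p 0 = m 0 -> strip p m.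
Proof.
move=> B ml nl pm0; split=> // t; split; last first.
  by have := B.2 t; have := ml.2 t; have := ml.2 t.+1; lia.
case: t => [|t]; first by rewrite pm0.
by have := B.2 t; have := B.2 t.+1; have := ml.2 t.+1; have := nl.2 t.+1;
   have := nl.2 t; lia.
Qed.

(* In a [burge] square, [p] and the carry are determined by [l], [m] and [n]. *)
Fixpoint burge_carry l m n t : nat :=
  if t is t'.+1 then
    burge_carry l m n t' + l t +
    maxn (l t.+1) (m t + n t - l t - burge_carry l m n t') - m t - n t
  else 0.

Definition burge_bot l m n t : nat :=
  if t is t'.+1 then
    maxn (l t.+1) (m t + n t - l t - burge_carry l m n t')
  else l 0.

Lemma burge_botP l m n : strip m l -> strip n l ->
  burge l m n (burge_bot l m n) (burge_carry l m n).
Proof.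
move=> ml nl; split=> // t /=.
have := ml.2 t; have := nl.2 t; have := ml.2 t.+1; have := nl.2 t.+1.
case: t => [|t] /=; first by have := ml.1; lia.
by lia.
Qed.

(** The equation prescribes the difference of [p t.+1] and [c t.+1]; as one of [c t.+1] and
    [p t.+1 - l t.+2] is zero and neither is negative, both are determined. *)
Lemma burge_uniq l m n p1 c1 p2 c2 : burge l m n p1 c1 -> burge l m n p2 c2 ->
  p1 0 = p2 0 -> forall t, p1 t = p2 t /\ c1 t = c2 t.
Proof.
move=> B1 B2 p0; elim=> [|t [ep ec]]; first by rewrite p0 B1.1 B2.1.
by have := B1.2 t; have := B2.2 t; have := B1.2 t.+1; have := B2.2 t.+1; lia.
Qed.

Definition rsk_bot l m n t : nat :=
  if t is t'.+1 then maxn (m t.+1) (n t.+1) + minn (m t) (n t) - l t.+1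
  else l 0.

Lemma rsk_botP l m n : strip m l -> strip n l ->
  [/\ rsk l m n (rsk_bot l m n), strip (rsk_bot l m n) m &
      strip (rsk_bot l m n) n].
Proof.
move=> ml nl; split.
- by move=> t /=; have := ml.2 t.+1; have := nl.2 t.+1; lia.
- split; first by rewrite /= ml.1.
  move=> t; have := ml.2 t; have := nl.2 t; have := ml.2 t.+1;
    have := nl.2 t.+1; have := ml.1.
  by case: t => [|t] /=; lia.
- split; first by rewrite /= nl.1.
  move=> t; have := ml.2 t; have := nl.2 t; have := ml.2 t.+1;
    have := nl.2 t.+1; have := nl.1.
  by case: t => [|t] /=; lia.
Qed.

Definition jdt_side l m p t : nat :=
  if t is t'.+1 then minn (p t') (l t) + maxn (p t) (l t.+1) - m t else l 0.

Lemma jdt_sideP l m p : strip m l -> strip p m ->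
  [/\ jdt l m (jdt_side l m p) p, strip (jdt_side l m p) l &
      strip p (jdt_side l m p)].
Proof.
move=> ml pm; split.
- move=> t /=; have := ml.2 t; have := pm.2 t.
  by have := ml.2 t.+1; have := pm.2 t.+1; lia.
- split=> // t; have := ml.2 t; have := pm.2 t; have := ml.2 t.+1;
    have := pm.2 t.+1.
  case: t => [|t] /=; first by lia.
  by have := ml.2 t; have := pm.2 t; lia.
- split; first by rewrite /= pm.1 ml.1.
  move=> t; have := ml.2 t; have := pm.2 t; have := ml.2 t.+1;
    have := pm.2 t.+1.
  have := pm.1; have := ml.1.
  case: t => [|t] /=; first by lia.
  by have := ml.2 t; have := pm.2 t; lia.
Qed.

(* Unprimed shapes have one more inner row.  With [m] and [n] exchanged this is
   the converse of the cube of [RemoveColumn], so it follows from the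
   uniqueness of the bottom of a [burge] square. *)
Section AddRow.

Variables (l m n p l' m' n' p' c' : nat -> nat).
Hypotheses (ml : strip m l) (nl : strip n l) (l'l : strip l' l).
Hypotheses (m'm : strip m' m) (p'p : strip p' p) (m'l' : strip m' l').
Hypothesis pn : p 0 = n 0.
Hypothesis B' : burge l' m' n' p' c'.
Hypothesis Jl : jdt l l' m m'.
Hypothesis Jn : jdt n n' p p'.
Hypothesis Rl : rsk l l' n n'.

Lemma add_row_cube : rsk m m' p p' /\ exists c, burge l m n p c.
Proof.
pose q := burge_bot l m n; pose c := burge_carry l m n.
have Bq : burge l n m q c by exact/burgeC/burge_botP.
have qn : strip q n by apply: burge_strip Bq nl ml _; rewrite nl.1.
have qm : strip q m by apply: burge_strip (burgeC Bq) ml nl _; rewrite ml.1.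
pose q' := rsk_bot m m' q.
have [Rm q'm' q'q] : [/\ rsk m m' q q', strip q' m' & strip q' q].
  exact: rsk_botP.
have Jq := remove_column_jdt nl ml qn qm l'l m'm m'l' Bq Jl q'q Rl Rm.
have Bq' := remove_column_burge nl ml qn qm l'l m'm m'l' Bq Jl q'q Rl Rm.
have q'0 : q' 0 = p' 0 by rewrite /q' /= ml.1 p'p.1 pn nl.1.
have eq' t : q' t = p' t by have [] := burge_uniq (burgeC Bq') B' q'0 t.
(* A [jdt] equation gives the shape [q] in terms of the other three, so equality of the primed
   shapes carries over. *)
have eq t : q t = p t.
  case: t => [|t]; first by rewrite /q /= pn nl.1.
  by have := Jq t; have := Jn t; rewrite !eq'; lia.
split; first by move=> t; rewrite -!eq -!eq'; exact: Rm.
by exists c; split; [exact: Bq.1 | move=> t; rewrite -!eq; have := Bq.2 t; lia].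
Qed.

End AddRow.

(** * Walks and the removal of the outermost row *)

(* [V.1 j] is the shape mu^j, and [V.2 j] the shape kappa^(j+1) between mu^j and
   mu^(j+1). *)
Definition walk_data := ((nat -> nat -> nat) * (nat -> nat -> nat))%type.

Definition walk (V : walk_data) :=
  (forall t, V.1 0 t.+1 = 0) /\
  forall j, strip (V.2 j) (V.1 j) /\ strip (V.2 j) (V.1 j.+1).

(* Deleting the first row also drops the first position: index [j] of [del V]
   lies below index [j.+1] of [V]. *)
Fixpoint del_top (V : walk_data) j : nat -> nat :=
  if j is j'.+1 then
    jdt_side (V.1 j.+1) (V.2 j)
      (rsk_bot (V.1 j) (V.2 j) (del_top V j'))
  else V.1 0.

Definition del_bot (V : walk_data) j :=
  rsk_bot (V.1 j.+1) (V.2 j.+1) (del_top V j).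

Definition del (V : walk_data) : walk_data := (del_top V, del_bot V).

Definition del_entry (V : walk_data) j :=
  V.1 j.+1 1 - maxn (V.2 j.+1 1) (del_top V j 1).

Lemma walk_start V : walk V -> strip (V.1 0) (V.1 1).
Proof.
case=> V0 VS; have [K0 K1] := VS 0; split; first by rewrite -K1.1 K0.1.
move=> t; have := K0.2 t; have := K1.2 t; have := K1.1; have := K0.1.
by case: t => [|t]; rewrite ?V0; lia.
Qed.

Lemma del_top_strip V : walk V -> forall j, strip (del_top V j) (V.1 j.+1).
Proof.
move=> Vw; elim=> [|j IH]; first exact: walk_start.
have [K1 K2] := Vw.2 j.+1.
have [_ bk _] := rsk_botP K1 IH.
by have [] := jdt_sideP K2 bk.
Qed.

Lemma del_faces V (Vw : walk V) j :
  [/\ rsk (V.1 j.+1) (V.2 j.+1) (del_top V j) (del_bot V j),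
      jdt (V.1 j.+2) (V.2 j.+1) (del_top V j.+1) (del_bot V j),
      strip (del_bot V j) (V.2 j.+1),
      strip (del_bot V j) (del_top V j) &
      strip (del_bot V j) (del_top V j.+1)].
Proof.
have [K1 K2] := Vw.2 j.+1.
have [R bk bt] := rsk_botP K1 (del_top_strip Vw j).
by have [J _ bt'] := jdt_sideP K2 bk.
Qed.

Lemma del_walk V : walk V -> walk (del V).
Proof.
move=> Vw; split=> [|j]; first exact: Vw.1.
by have [_ _ _] := del_faces Vw j.
Qed.

Lemma iter_del_walk V s : walk V -> walk (iter s del V).
Proof. by move=> Vw; elim: s => //= s; exact: del_walk. Qed.

(* [W] is [V] with the outermost column removed; the condition only concerns
   the first [b] positions, which precede that column. *)
Definition removes_column b (V W : walk_data) :=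
  (forall j, j <= b -> strip (W.1 j) (V.1 j)) /\
  forall j, j < b ->
    [/\ strip (W.2 j) (V.2 j), jdt (V.1 j) (V.2 j) (W.1 j) (W.2 j) &
        rsk (V.1 j.+1) (V.2 j) (W.1 j.+1) (W.2 j)].

(** * Removing the outermost row commutes with removing the outermost column *)

Section Commutation.

Variables (V W : walk_data) (b : nat).
Hypotheses (Vw : walk V) (Ww : walk W) (VW : removes_column b.+1 V W).

Let corner j := strip (del_top W j) (del_top V j) /\
  exists c, burge (V.1 j.+1) (del_top V j) (W.1 j.+1) (del_top W j) c.

Lemma corner0 : corner 0.
Proof.
have S0 := VW.1 0 isT; have S1 := VW.1 1 isT; split; first exact: S0.
(* At position 1 only the outermost row is present, and deleting it leaves empty shapes. The carry
   is thus the whole entry of the corner cell from level 1 on. *)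
exists (fun t => if t is 0 then 0 else V.1 1 1 - W.1 1 1); split=> // t /=.
have := walk_start Vw; have := walk_start Ww; move=> WS VS.
have := VS.2 t; have := WS.2 t; have := S1.2 t; have := VS.1; have := S1.1.
have := S0.1; have := WS.1.
case: t => [|t]; rewrite ?Vw.1 ?Ww.1; first by have := S1.2 1; lia.
by have := S1.2 t.+2; lia.
Qed.

Lemma corner_step j : j < b -> corner j ->
  [/\ corner j.+1, del_entry V j = del_entry W j,
      strip (del_bot W j) (del_bot V j),
      jdt (del_top V j) (del_bot V j) (del_top W j) (del_bot W j) &
      rsk (del_top V j.+1) (del_bot V j) (del_top W j.+1) (del_bot W j)].
Proof.
move=> jb [Sj [c Bj]].
have VS1 := VW.1 j.+1 (ltnW jb); have VS2 := VW.1 j.+2 jb.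
have [KS KJ KR] := VW.2 j.+1 jb.
have [VR VJ Vb Vt Vt'] := del_faces Vw j.
have [WR WJ Wb Wt Wt'] := del_faces Ww j.
have [Vk Vk'] := Vw.2 j.+1; have [Wk Wk'] := Ww.2 j.+1.
have Vs := del_top_strip Vw j; have Ws := del_top_strip Ww j.
(* First half of the step: the inner column is dropped, passing from [V.1 j.+1] to [V.2 j.+1]. *)
have J' := remove_column_jdt Vs VS1 Sj Ws Vk Wk KS Bj KJ Wt VR WR.
have B' := remove_column_burge Vs VS1 Sj Ws Vk Wk KS Bj KJ Wt VR WR.
have E' := remove_column_entry Vs VS1 Sj Ws Vk Wk KS Bj KJ.
have Sb : strip (del_bot W j) (del_bot V j).
  apply: burge_strip B' Vb KS _.
  by rewrite Wt.1 Sj.1 -Vt.1.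
have Vs' := del_top_strip Vw j.+1; have Ws' := del_top_strip Ww j.+1.
(* Second half: the next inner row is added, passing from [V.2 j.+1] to [V.1 j.+2]. *)
have [R' [c' B'']] := add_row_cube Vs' VS2 Vk' Vt' Wt' Vb Ws'.1 B' VJ WJ KR.
have St : strip (del_top W j.+1) (del_top V j.+1).
  apply: burge_strip B'' Vs' VS2 _.
  by rewrite -Wt'.1 Sb.1 Vt'.1.
split=> //; first by split=> //; exists c'.
have := E'; rewrite /del_entry.
have := Vk.2 1; have := Vs.2 1; have := Wk.2 1; have := Ws.2 1.
by lia.
Qed.

Lemma cornerP j : j <= b -> corner j.
Proof.
elim: j => [|j IH] jb; first exact: corner0.
by case: (corner_step jb (IH (ltnW jb))).
Qed.

Lemma del_entry_removes_column j : j < b -> del_entry V j = del_entry W j.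
Proof. by move=> jb; case: (corner_step jb (cornerP (ltnW jb))). Qed.

Lemma del_removes_column : removes_column b (del V) (del W).
Proof.
split=> j jb; first by case: (cornerP jb).
by case: (corner_step jb (cornerP (ltnW jb))).
Qed.

End Commutation.

(** * Recovering a walk from its deletion and the deleted entries *)

Definition eqwalk (V W : walk_data) :=
  forall j t, V.1 j t = W.1 j t /\ V.2 j t = W.2 j t.

Definition vanishes_from N (V : walk_data) :=
  forall j t, N <= j -> V.1 j t.+1 = 0.

Lemma walk_lev0 V : walk V -> forall j, V.1 j 0 = V.1 0 0 /\ V.2 j 0 = V.1 0 0.
Proof.
move=> Vw; elim=> [|j [IH _]].
  by split=> //; rewrite (Vw.2 0).1.1.
have e : V.1 j.+1 0 = V.1 0 0 by rewrite -(Vw.2 j).2.1 (Vw.2 j).1.1.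
by rewrite e (Vw.2 j.+1).1.1 e.
Qed.

Lemma eqwalk_vanishing V W : walk V -> walk W -> V.1 0 0 = W.1 0 0 ->
  vanishes_from 0 V -> vanishes_from 0 W -> eqwalk V W.
Proof.
move=> Vw Ww VW00 V0 W0 j [|t].
  by have [-> ->] := walk_lev0 Vw j; have [-> ->] := walk_lev0 Ww j.
have := (Vw.2 j).1.2 t.+1; have := (Ww.2 j).1.2 t.+1.
by rewrite V0 ?W0 //; lia.
Qed.

Lemma del_vanishes N V :
  walk V -> vanishes_from N.+1 V -> vanishes_from N (del V).
Proof.
move=> Vw V0 j t Nj /=; have := (del_top_strip Vw j).2 t.+1.
by rewrite (V0 j.+1 t Nj); lia.
Qed.

Lemma del_inj N V W : walk V -> walk W -> V.1 0 0 = W.1 0 0 ->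
    vanishes_from N V -> vanishes_from N W ->
    eqwalk (del V) (del W) -> (forall j, del_entry V j = del_entry W j) ->
  eqwalk V W.
Proof.
move=> Vw Ww VW00 VN WN eqD eqE.
have V0 := walk_lev0 Vw; have W0 := walk_lev0 Ww.
(* The walk is rebuilt from right to left, starting at positions from [N] on, where both walks are
   empty; [i] bounds the distance still to go. *)
have eqS i j : N <= i + j -> forall t, V.1 j.+1 t = W.1 j.+1 t.
  elim: i j => [|i IH] j Nij t.
    case: t => [|t]; first by rewrite (V0 _).1 (W0 _).1.
    by rewrite VN ?WN //; lia.
  have {}IH t' : V.1 j.+2 t' = W.1 j.+2 t' by apply: IH; lia.
  have [VR VJ Vb Vt Vt'] := del_faces Vw j.
  have [WR WJ Wb Wt Wt'] := del_faces Ww j.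
  have K t' : V.2 j.+1 t' = W.2 j.+1 t'.
    case: t' => [|t']; first by rewrite (V0 _).2 (W0 _).2.
    have := VJ t'; have := WJ t'; rewrite !IH.
    have := eqD j.+1 t'.+1; have := eqD j t'; have := eqD j t'.+1.
    by rewrite /= => -[_ ->] [_ ->] [-> _]; lia.
  (* The [rsk] rule recovers the levels from 2 on; level 1 is exactly what the deleted entry
     records. *)
  case: t => [|[|t]]; first by rewrite (V0 _).1 (W0 _).1.
    have := eqE j; rewrite /del_entry K; have [/= -> _] := eqD j 1.
    have := (Vw.2 j.+1).1.2 1; have := (Ww.2 j.+1).1.2 1.
    have := (del_top_strip Vw j).2 1; have := (del_top_strip Ww j).2 1.
    by have [/= -> _] := eqD j 1; rewrite K; lia.
  have := VR t; have := WR t; rewrite !K.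
  have [/= -> ->] := eqD j t.+1; have [/= -> _] := eqD j t.+2.
  by lia.
have eqU j t : V.1 j t = W.1 j t.
  case: j => [|j]; last by apply: (eqS N); lia.
  by case: t => // t; rewrite Vw.1 Ww.1.
move=> j t; split; first exact: eqU.
case: t => [|t]; first by rewrite (V0 _).2 (W0 _).2.
case: j => [|j].
  have := (Vw.2 0).1.2 t.+1; have := (Ww.2 0).1.2 t.+1.
  by rewrite Vw.1 Ww.1; lia.
have [VR VJ Vb Vt Vt'] := del_faces Vw j.
have [WR WJ Wb Wt Wt'] := del_faces Ww j.
have := VJ t; have := WJ t; rewrite !eqU.
have := eqD j.+1 t.+1; have := eqD j t; have := eqD j t.+1.
by rewrite /= => -[_ ->] [_ ->] [-> _]; lia.
Qed.

(** * Promotion in terms of levels *)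

Definition interlaced (x y : nat -> nat) :=
  x 0 = y 0 /\ forall t, x t.+1 <= y t /\ y t.+1 <= x t.

Definition parity_levels q (x : nat -> nat) :=
  forall t, odd (q + t) -> x t = x t.+1.

Definition decreasing (x : nat -> nat) := forall t, x t.+1 <= x t.

Definition minl (x y : nat -> nat) t := minn (x t) (y t).

(* The levels of [e = dom (c + b - a)] when the entries of [a] have the parity
   of [q]; the other levels follow from [parity_levels]. *)
Definition promotion_levels q (a b c e : nat -> nat) := forall t,
  ~~ odd (q + t) ->
  a t.+2 + e t.+2 = maxn (b t.+3) (c t.+3) + minn (b t.+1) (c t.+1).

Lemma interlacedC x y : interlaced x y -> interlaced y x.
Proof. by case=> xy0 xy; split=> // t; have := xy t; lia. Qed.

Lemma parity_levelsSS q x : parity_levels q x -> parity_levels q.+2 x.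
Proof. by move=> px t o; apply: px; lia. Qed.

Lemma minl_strip x y : decreasing x -> interlaced x y ->
  strip (minl x y) x.
Proof.
move=> dx xy; split; first by rewrite /minl xy.1; lia.
by move=> t; rewrite /minl; have := dx t; have := xy.2 t; lia.
Qed.

Lemma minlC x y t : minl x y t = minl y x t.
Proof. by rewrite /minl minnC. Qed.

Lemma eq_rsk_bot l m n1 n2 : n1 =1 n2 -> rsk_bot l m n1 =1 rsk_bot l m n2.
Proof. by move=> e [|t] //=; rewrite !e. Qed.

Lemma eq_jdt_side l m p1 p2 : p1 =1 p2 -> jdt_side l m p1 =1 jdt_side l m p2.
Proof. by move=> e [|t] //=; rewrite !e. Qed.

Lemma rsk_strip l m n p :
  rsk l m n p -> strip m l -> strip n l -> p 0 = m 0 -> strip p m.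
Proof.
move=> R ml nl p0; split=> // -[|t].
  by have := ml.2 0; have := ml.2 1; lia.
have := R t; have := ml.2 t.+1; have := nl.2 t.+1.
by have := ml.2 t.+2; have := nl.2 t.+2; lia.
Qed.

Section FanSquare.

Variables (q : nat) (a b c e : nat -> nat).
Hypotheses (ab : interlaced a b) (ac : interlaced a c).
Hypotheses (be : interlaced b e) (ce : interlaced c e).
Hypotheses (pa : parity_levels q a) (pb : parity_levels q.+1 b).
Hypotheses (pc : parity_levels q.+1 c) (pe : parity_levels q e).
Hypothesis Pe : promotion_levels q a b c e.

(** The centre of a promotion square with corners [a], [b], [c], [e]. With the minima as midpoints
    of the edges it cuts the square into four: [rsk] at [a] and [e], [jdt] at [b] and [c]. *)
Let rho := rsk_bot a (minl a b) (minl a c).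

(** By parity and interlacing one term of [rsk_bot] equals the subtracted level of [a] and cancels:
    the minimum here, the maximum in [rho_even]. *)
Lemma rho_odd t : odd (q + t.+1) -> rho t.+1 = maxn (b t.+2) (c t.+2).
Proof.
move=> o; have := pa o; have := @pb t.+2; have := @pc t.+2.
have -> : odd (q.+1 + t.+2) = odd (q + t.+1) by lia.
move=> /(_ o) ? /(_ o) ?; rewrite /rho /rsk_bot /minl.
by have := ab.2 t.+1; have := ac.2 t.+1; have := ab.2 t.+2; have := ac.2 t.+2;
   lia.
Qed.

Lemma rho_even t : ~~ odd (q + t) -> rho t = minn (b t) (c t).
Proof.
case: t => [|t] o; first by rewrite /rho /= ab.1 -ac.1 ab.1; lia.
have o' : odd (q.+1 + t.+1) by lia.
have o2 : odd (q + t.+2) by lia.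
have := pa o2; have := pb o'; have := pc o'; rewrite /rho /rsk_bot /minl.
by have := ab.2 t.+1; have := ac.2 t.+1; have := ab.2 t.+2; have := ac.2 t.+2;
   lia.
Qed.

Lemma square_jdt_side : jdt_side b (minl a b) rho =1 minl b e.
Proof.
case=> [|t]; first by rewrite /minl /=; have := be.1; lia.
rewrite /jdt_side /minl; have [o|o] := boolP (odd (q + t.+1)).
  have o' : ~~ odd (q + t) by lia.
  rewrite rho_odd // rho_even //; have := pa o; have := pe o.
  have o2 : odd (q.+1 + t.+2) by lia.
  have o3 : odd (q.+1 + t) by lia.
  have := pb o2; have := pc o2; have := pb o3; have := pc o3.
  have := ab.2 t; have := ac.2 t; have := be.2 t; have := ce.2 t.
  have := ab.2 t.+1; have := ac.2 t.+1; have := be.2 t.+1; have := ce.2 t.+1.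
  by have := Pe o'; lia.
have o' : odd (q.+1 + t.+1) by lia.
have := pb o'; have := pc o'; rewrite (rho_even o).
have := ab.2 t.+1; have := ac.2 t.+1; have := be.2 t.+1; have := ce.2 t.+1.
have := ab.2 t; have := ac.2 t; have := be.2 t; have := ce.2 t.
case: t o o' => [|t] o o'.
  by rewrite /rho /=; have := be.1; have := ab.1; have := ac.1; lia.
by rewrite rho_odd; lia.
Qed.

Lemma square_jdt : jdt c (minl c e) (minl a c) rho.
Proof.
move=> t; rewrite /minl; have [o|o] := boolP (odd (q + t.+1)).
  have o' : ~~ odd (q + t) by lia.
  rewrite rho_odd // rho_even //; have := pa o; have := pe o.
  have o2 : odd (q.+1 + t.+2) by lia.
  have o3 : odd (q.+1 + t) by lia.
  have := pb o2; have := pc o2; have := pb o3; have := pc o3.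
  have := ab.2 t; have := ac.2 t; have := be.2 t; have := ce.2 t.
  have := ab.2 t.+1; have := ac.2 t.+1; have := be.2 t.+1; have := ce.2 t.+1.
  by have := Pe o'; lia.
have o' : odd (q.+1 + t.+1) by lia.
have := pb o'; have := pc o'; rewrite (rho_even o).
have := ab.2 t.+1; have := ac.2 t.+1; have := be.2 t.+1; have := ce.2 t.+1.
have := ab.2 t; have := ac.2 t; have := be.2 t; have := ce.2 t.
case: t o o' => [|t] o o'.
  by rewrite /rho /=; have := be.1; have := ab.1; have := ac.1; lia.
by rewrite rho_odd; lia.
Qed.

Lemma square_rsk : rsk e (minl c e) (minl b e) rho.
Proof.
move=> t; rewrite /minl; have [o|o] := boolP (odd (q + t.+1)).
  rewrite rho_odd //; have := pa o; have := pe o.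
  have o2 : odd (q.+1 + t.+2) by lia.
  have := pb o2; have := pc o2.
  have := be.2 t.+1; have := ce.2 t.+1; have := be.2 t.+2; have := ce.2 t.+2.
  by lia.
rewrite rho_even //; have o' : odd (q.+1 + t.+1) by lia.
have := pb o'; have := pc o'; have o2 : odd (q + t.+2) by lia.
have := pe o2.
have := be.2 t.+1; have := ce.2 t.+1; have := be.2 t.+2; have := ce.2 t.+2.
by lia.
Qed.

End FanSquare.

Definition minwalk (A : nat -> nat -> nat) : walk_data :=
  (A, fun j => minl (A j) (A j.+1)).

Lemma minwalk_walk A : (forall t, A 0 t.+1 = 0) ->
    (forall j, decreasing (A j)) -> (forall j, interlaced (A j) (A j.+1)) ->
  walk (minwalk A).
Proof.
move=> A0 dA iA; split=> // j; split; first exact: minl_strip.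
have [S0 S] := minl_strip (dA j.+1) (interlacedC (iA j)).
by split=> [|t]; rewrite /= minlC.
Qed.

(** * Promotion as the removal of a column *)

Section Promotion.

Variables (n : nat) (A E : nat -> nat -> nat).
Hypothesis n_gt0 : 0 < n.
Hypotheses (A0 : forall t, A 0 t.+1 = 0) (E0 : forall t, E 0 t.+1 = 0).
Hypothesis dE : forall j, decreasing (E j).
Hypotheses (iA : forall j, interlaced (A j) (A j.+1)).
Hypotheses (iE : forall j, interlaced (E j) (E j.+1)).
Hypothesis iEA : forall j, j < n -> interlaced (E j) (A j.+1).
Hypotheses (pA : forall j, j <= n -> parity_levels j (A j)).
Hypothesis pE : forall j, j <= n -> parity_levels j (E j).
Hypothesis PAE : forall j, j.+1 < n ->
  promotion_levels j.+1 (A j.+1) (A j.+2) (E j) (E j.+1).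

(** Induction along the walk: the quarters of the promotion square at [a] and [b] are the two
    squares that [del] completes in one step. *)
Lemma del_promotion j : j < n ->
  del_top (minwalk A) j =1 minl (A j.+1) (E j).
Proof.
elim: j => [|j IH] jn.
  case=> [|t].
    by rewrite /minl /=; have := (iEA jn).1; have := (iA 0).1; lia.
  by rewrite /minl /= A0 E0; lia.
have jn' := ltnW jn; have {}IH := IH jn'.
have S := square_jdt_side (iA j.+1)
  (interlacedC (iEA jn')) (interlacedC (iEA jn)) (iE j)
  (pA jn') (pA jn) (parity_levelsSS (pE (ltnW jn'))) (pE jn') (PAE jn).
by move=> t; rewrite -S; apply/eq_jdt_side/eq_rsk_bot.
Qed.

Lemma del_bot_promotion j : j < n -> del_bot (minwalk A) j =1
  rsk_bot (A j.+1) (minl (A j.+1) (A j.+2)) (minl (A j.+1) (E j)).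
Proof. by move=> jn; apply/eq_rsk_bot/del_promotion. Qed.

(** The other two quarters, at [c] and [e], say that the same deleted walk arises from the walk of
    [E] by dropping its outermost column. *)
Lemma promotion_removes_column :
  removes_column n.-1 (minwalk E) (del (minwalk A)).
Proof.
have lt_n j : j < n.-1 -> j.+1 < n by lia.
have S j : j < n -> strip (del_top (minwalk A) j) (E j).
  move=> jn; have [M0 M] := minl_strip (dE j) (iEA jn).
  by split=> [|t]; rewrite !del_promotion // minlC.
split=> [j jn|j /lt_n jn]; first by apply: S; lia.
have jn' := ltnW jn.
have J := square_jdt (iA j.+1)
  (interlacedC (iEA jn')) (interlacedC (iEA jn)) (iE j)
  (pA jn') (pA jn) (parity_levelsSS (pE (ltnW jn'))) (pE jn') (PAE jn).
have R := square_rsk (iA j.+1)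
  (interlacedC (iEA jn')) (interlacedC (iEA jn)) (iE j)
  (pA jn') (pA jn) (parity_levelsSS (pE (ltnW jn'))) (pE jn').
have R' : rsk (E j.+1) (minl (E j) (E j.+1)) (del_top (minwalk A) j.+1)
    (del_bot (minwalk A) j).
  move=> t; rewrite del_bot_promotion // !del_promotion //; exact: R.
split=> //; last first.
  by move=> t /=; rewrite !del_bot_promotion // !del_promotion //; exact: J.
apply: (rsk_strip R'); last 1 first.
- by rewrite del_bot_promotion //= /minl -(iE j).1 (iEA jn').1; lia.
- have [M0 M] := minl_strip (dE j.+1) (interlacedC (iE j)).
  by split=> [|t]; rewrite minlC.
- exact: S.
Qed.

Lemma del_entry_promotion j : j < n -> del_entry (minwalk A) j =
  A j.+1 1 - maxn (minn (A j.+1 1) (A j.+2 1)) (minn (A j.+1 1) (E j 1)).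
Proof. by move=> jn; rewrite /del_entry del_promotion. Qed.

End Promotion.

(** * Fans *)

Section Levels.

Variable r : nat.
Implicit Types x y a b c e : 'rV[int]_r.

Definition lev x t := \sum_(k < r) (t <= `|x ord0 k|).

Definition unit_step x y :=
  forall k, (y ord0 k = x ord0 k + 1 \/ y ord0 k = x ord0 k - 1)%R.

Definition near x y := forall k : 'I_r,
  `|x ord0 k| <= `|y ord0 k|.+1 /\ `|y ord0 k| <= `|x ord0 k|.+1.

Definition has_parity q x := forall k : 'I_r, odd `|x ord0 k| = odd q.

Lemma is_partitionP x : is_partition x <->
  (forall k, 0 <= x ord0 k)%R /\
  (forall k l : 'I_r, (k <= l)%N -> x ord0 l <= x ord0 k)%R.
Proof.
split=> [/andP[/forallP x0 /forallP xd]|[x0 xd]].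
  by split=> // k l kl; have /forallP/(_ l)/implyP := xd k; apply.
apply/andP; split; apply/forallP => // k; apply/forallP => l.
by apply/implyP; apply: xd.
Qed.

Lemma unit_stepC x y : unit_step x y -> unit_step y x.
Proof. by move=> xy k; have := xy k; lia. Qed.

Lemma unit_step_near x y : unit_step x y -> near x y.
Proof. by move=> xy k; have := xy k; lia. Qed.

Lemma unit_step_parity q x y :
  unit_step x y -> has_parity q x -> has_parity q.+1 y.
Proof. by move=> xy px k; have := xy k; have := px k; lia. Qed.

Lemma lev_0 x : lev x 0 = r.
Proof. by rewrite /lev sum_nat_const card_ord muln1. Qed.

Lemma lev_decreasing x : decreasing (lev x).
Proof. by move=> t; apply: leq_sum => k _; lia. Qed.

Lemma lev_near x y : near x y -> interlaced (lev x) (lev y).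
Proof.
move=> xy; split=> [|t]; first by rewrite !lev_0.
by split; apply: leq_sum => k _; have := xy k; lia.
Qed.

Lemma lev_parity q x : has_parity q x -> parity_levels q (lev x).
Proof.
by move=> px t o; apply: eq_bigr => k _; have := px k; lia.
Qed.

Lemma sum_lt w : w <= r -> \sum_(k < r) (k < w) = w.
Proof.
move=> wr; transitivity (\sum_(k < w) 1); last first.
  by rewrite sum_nat_const card_ord muln1.
rewrite (big_ord_widen r (fun=> 1) wr) [RHS]big_mkcond.
by apply: eq_bigr => k _; case: (k < _).
Qed.

Lemma lev_le x t : lev x t <= r.
Proof.
rewrite -[X in _ <= X](lev_0 x); elim: t => // t IH.
exact: leq_trans (lev_decreasing x t) IH.
Qed.

(** The entries decrease, so those of size at least [t] occupy an initial segment of indices; the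
    count is compared with that of a known segment by [sum_lt]. *)
Lemma lev_gt x t (k : 'I_r) : is_partition x ->
  (k < lev x t) = (t <= `|x ord0 k|).
Proof.
move=> /is_partitionP[x0 xd]; apply/idP/idP => [|tk].
  apply: contraTT => tk; rewrite -leqNgt.
  rewrite -[X in _ <= X](@sum_lt k) ?(ltnW (ltn_ord k)) //.
  apply: leq_sum => l _; have := xd k l; have := x0 l; have := x0 k.
  by case: (ltnP l k) tk => //=; case: (t <= _) / idP => //; lia.
rewrite -(@sum_lt k.+1) ?ltn_ord //; apply: leq_sum => l _.
have := xd l k; have := x0 l; have := x0 k.
by case: (ltnP l k.+1) tk => //=; case: (t <= _) / idP => //; lia.
Qed.

Lemma lev_inj x y : is_partition x -> is_partition y -> lev x =1 lev y -> x = y.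
Proof.
move=> px py xy; apply/rowP => k; change (x ord0 k = y ord0 k).
have le t : (t <= `|x ord0 k|) = (t <= `|y ord0 k|) by rewrite -!lev_gt // xy.
have x_le_y : `|x ord0 k| <= `|y ord0 k| by rewrite -le.
have y_le_x : `|y ord0 k| <= `|x ord0 k| by rewrite le.
have /is_partitionP[/(_ k) + _] := px; have /is_partitionP[/(_ k) + _] := py.
by lia.
Qed.

Lemma dom_mem x k : exists l, (dom x ord0 k = `|x ord0 l|)%R.
Proof.
rewrite /dom mxE; set s := sort _ _.
have /(mem_nth 0%R) : k < size s by rewrite size_sort size_map size_enum_ord.
by rewrite mem_sort => /mapP[l _ ->]; exists l.
Qed.

Lemma dom_partition x : is_partition (dom x).
Proof.
apply/is_partitionP; split=> [k|k l kl].
  by have [l ->] := dom_mem x k; apply: normr_ge0.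
rewrite /dom !mxE; set s := sort _ _.
have ss : size s = r by rewrite size_sort size_map size_enum_ord.
have st : sorted >=%O s by apply: sort_sorted => u v; apply: le_total.
apply: (sorted_leq_nth _ _ _ st) => //; rewrite ?inE ?ss ?ltn_ord //.
  by move=> u v w uv vw; apply: le_trans vw uv.
exact: lexx.
Qed.

Lemma lev_dom x : lev (dom x) =1 lev x.
Proof.
move=> t; rewrite /lev /dom; under eq_bigr do rewrite mxE.
set s := sort _ _.
have ss : size s = r by rewrite size_sort size_map size_enum_ord.
transitivity (\sum_(y <- s) (t <= `|y|)).
  by rewrite (big_nth 0%R) ss big_mkord.
rewrite (perm_big [seq `|x ord0 l|%R | l <- enum 'I_r]) ?perm_sort //=.
by rewrite big_map big_enum; apply: eq_bigr => k _; rewrite normr_id || lia.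
Qed.

Lemma num_negE x : num_neg x = \sum_(k < r) (x ord0 k < 0)%R.
Proof.
rewrite /num_neg -sum1_card big_mkcond; apply: eq_bigr => k _.
by rewrite inE; case: (_ < _)%R.
Qed.

(** The two index sets are initial segments, hence nested, so counting commutes with maxima, and
    likewise with minima. This lets identities between levels be checked entry by entry. *)
Lemma sum_max b c s t : is_partition b -> is_partition c ->
  \sum_(k < r) maxn (s <= `|b ord0 k|) (t <= `|c ord0 k|) =
  maxn (lev b s) (lev c t).
Proof.
move=> pb pc; rewrite -[RHS]sum_lt ?geq_max ?lev_le //.
apply: eq_bigr => k _; rewrite -!lev_gt // leq_max.
by do 2!case: (k < _).
Qed.

Lemma sum_min b c s t : is_partition b -> is_partition c ->
  \sum_(k < r) minn (s <= `|b ord0 k|) (t <= `|c ord0 k|) =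
  minn (lev b s) (lev c t).
Proof.
move=> pb pc; rewrite -[RHS]sum_lt ?geq_min ?lev_le //.
apply: eq_bigr => k _; rewrite -!lev_gt // leq_min.
by do 2!case: (k < _).
Qed.

(** * The promotion rule at a single position *)

Section LocalRule.

Variables (q : nat) (a b c : 'rV[int]_r).
Hypotheses (Pa : is_partition a) (Pb : is_partition b) (Pc : is_partition c).
Hypotheses (ab : unit_step a b) (ac : unit_step a c) (qa : has_parity q a).

Let x : 'rV[int]_r := (c + b - a)%R.
Let e := dom x.

Let pos k : [/\ 0 <= a ord0 k, 0 <= b ord0 k & 0 <= c ord0 k]%R.
Proof.
by have [] := (is_partitionP a).1 Pa; have [] := (is_partitionP b).1 Pb;
   have [] := (is_partitionP c).1 Pc.
Qed.

Let xE k : (x ord0 k = c ord0 k + b ord0 k - a ord0 k)%R.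
Proof. by rewrite !mxE. Qed.

(** An entry of [c + b - a] is negative exactly when that of [a] is positive and those of [b] and
    [c] are zero. *)
Lemma num_neg_levels : num_neg x =
  lev a 1 - maxn (minn (lev a 1) (lev b 1)) (minn (lev a 1) (lev c 1)).
Proof.
suff : num_neg x + minn (lev a 1) (maxn (lev b 1) (lev c 1)) = lev a 1 by lia.
have -> : minn (lev a 1) (maxn (lev b 1) (lev c 1)) =
    \sum_(k < r) minn (0 < `|a ord0 k|)
      (maxn (0 < `|b ord0 k|) (0 < `|c ord0 k|)).
  rewrite -[LHS]sum_lt ?geq_min ?lev_le //; apply: eq_bigr => k _.
  by rewrite -!lev_gt // leq_min leq_max; do 3!case: (k < _).
rewrite num_negE -big_split /=; apply: eq_bigr => k _.
by rewrite xE; have [] := pos k; have := ab k; have := ac k; lia.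
Qed.

Lemma dom_promotion_levels : promotion_levels q (lev a) (lev b) (lev c) (lev e).
Proof.
move=> t o; rewrite lev_dom -sum_max // -sum_min // /lev -!big_split /=.
apply: eq_bigr => k _; rewrite xE.
have [] := pos k; have := qa k.
by case: (ab k) => ->; case: (ac k) => ->; lia.
Qed.

Lemma dom_parity : has_parity q e.
Proof.
move=> k; rewrite /e; have [l ->] := dom_mem x k.
by rewrite xE; have := ab l; have := ac l; have := qa l; lia.
Qed.

(** Interlacing of levels survives sorting and bounds the difference of each pair of entries by 1;
    opposite parities exclude 0. *)
Lemma dom_unit_step y :
  is_partition y -> has_parity q.+1 y -> near x y -> unit_step y e.
Proof.
move=> Py qy xy k; have [_ lxy] := lev_near xy.
have := (is_partitionP e).1 (dom_partition x); case=> /(_ k) e0 _.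
have [/(_ k) y0 _] := (is_partitionP y).1 Py.
have ek : ~~ (`|y ord0 k|.+2 <= `|e ord0 k|).
  rewrite -lev_gt ?dom_partition // lev_dom -leqNgt.
  by apply: leq_trans (lxy _).1 _; rewrite leqNgt lev_gt // ltnn.
have yk : ~~ (`|e ord0 k|.+2 <= `|y ord0 k|).
  rewrite -lev_gt // -leqNgt; apply: leq_trans (lxy _).2 _.
  by rewrite -lev_dom leqNgt lev_gt ?dom_partition // ltnn.
by have := dom_parity k; have := qy k; lia.
Qed.

Lemma dom_unit_step_left : unit_step c e.
Proof.
apply: dom_unit_step => //; first exact: unit_step_parity ac qa.
by move=> k; rewrite xE; have [] := pos k; have := ab k; lia.
Qed.

Lemma dom_unit_step_right : unit_step b e.
Proof.
apply: dom_unit_step => //; first exact: unit_step_parity ab qa.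
by move=> k; rewrite xE; have [] := pos k; have := ac k; lia.
Qed.

End LocalRule.

End Levels.

Section FanLevels.

Variables r n : nat.
Implicit Type T : n.+1.-tuple 'rV[int]_r.

Lemma is_partition0 : is_partition (0%R : 'rV[int]_r).
Proof. by apply/is_partitionP; split=> *; rewrite !mxE. Qed.

Lemma lev_zero t : lev (0%R : 'rV[int]_r) t.+1 = 0.
Proof. by rewrite /lev big1 // => k _; rewrite mxE. Qed.

Lemma is_fanP T : is_fan T <->
  [/\ nth 0%R T 0 = 0%R, nth 0%R T n = 0%R,
      forall j, is_partition (nth 0%R T j) &
      forall j, j < n -> unit_step (nth 0%R T j) (nth 0%R T j.+1)].
Proof.
split.
  case/and4P=> /eqP T0 /eqP Tn /allP TP /forallP TS; split=> // j.
    have [jn|nj] := ltnP j n.+1; last first.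
      by rewrite nth_default ?size_tuple ?is_partition0.
    by apply/TP/mem_nth; rewrite size_tuple.
  move=> jn k; have /forallP/(_ k) := TS (Ordinal jn).
  by rewrite !mxE !inE /= => /orP[] /eqP; lia.
case=> T0 Tn TP TS; apply/and4P; split; first exact/eqP.
- exact/eqP.
- by apply/allP => x /(nthP 0%R)[j _ <-].
- apply/forallP => j; apply/forallP => k; have := TS j (ltn_ord j) k.
  by rewrite !mxE !inE => -[->|->]; rewrite addrAC subrr add0r.
Qed.

Lemma nth_pr T j : j < n -> nth 0%R (pr T) j = pr_aux (nth 0%R T) j.
Proof.
move=> jn; have jn' : j < n.+1 by lia.
have := nth_mktuple (fun i : 'I_n.+1 =>
  if i == n :> nat then 0%R else pr_aux (nth 0%R T) i) 0%R (Ordinal jn').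
by move=> /= ->; case: eqP => //; lia.
Qed.

Lemma nth_pr_last T : nth 0%R (pr T) n = 0%R.
Proof.
have := nth_mktuple (fun i : 'I_n.+1 =>
  if i == n :> nat then 0%R else pr_aux (nth 0%R T) i) 0%R ord_max.
by move=> /= ->; rewrite eqxx.
Qed.

Section Fan.

Variable T : n.+1.-tuple 'rV[int]_r.
Hypothesis Tfan : is_fan T.

Let mu := nth 0%R T.
Let nu := nth 0%R (pr T).

Let mu0 : mu 0 = 0%R. Proof. by case: ((is_fanP T).1 Tfan). Qed.
Let mun : mu n = 0%R. Proof. by case: ((is_fanP T).1 Tfan). Qed.
Let muP j : is_partition (mu j). Proof. by case: ((is_fanP T).1 Tfan). Qed.
Let muS j : j < n -> unit_step (mu j) (mu j.+1).
Proof. by case: ((is_fanP T).1 Tfan) => _ _ _; apply. Qed.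

Lemma fan_parity j : j <= n -> has_parity j (mu j).
Proof.
elim: j => [|j IH] jn; first by move=> k; rewrite mu0 mxE.
by apply: unit_step_parity (muS jn) (IH (ltnW jn)).
Qed.

Lemma pr_rec j : j.+1 < n -> nu j.+1 = dom (nu j + mu j.+2 - mu j.+1)%R.
Proof. by move=> jn; rewrite /nu !nth_pr //; lia. Qed.

Lemma pr_unit_step j : j < n ->
  is_partition (nu j) /\ unit_step (nu j) (mu j.+1).
Proof.
elim: j => [|j IH] jn.
  rewrite /nu nth_pr //= -mu0; split; first exact: muP.
  exact: muS.
have [Pj Sj] := IH (ltnW jn); rewrite pr_rec //.
split; first exact: dom_partition.
apply: unit_stepC; apply: (@dom_unit_step_right r j.+1) => //.
- exact: muS.
- exact: unit_stepC.
- exact/fan_parity/ltnW.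
Qed.

Lemma pr_fan : is_fan (pr T).
Proof.
apply/is_fanP; split.
- case: (posnP n) => [n0|n0]; last by rewrite nth_pr.
  by rewrite -[X in nth _ _ X]n0 nth_pr_last.
- exact: nth_pr_last.
- move=> j; have [jn|nj] := ltnP j n; first by case: (pr_unit_step jn).
  have [->|jn] := eqVneq j n; first by rewrite nth_pr_last is_partition0.
  by rewrite nth_default ?size_tuple ?is_partition0 //; lia.
move=> j jn; have [Pj Sj] := pr_unit_step jn.
have [jn1|nj] := ltnP j.+1 n.
  rewrite -/(nu _) -/(nu _) pr_rec //.
  apply: (@dom_unit_step_left r j.+1) => //.
  - exact: muS.
  - exact: unit_stepC.
  - exact: fan_parity.
have e : j.+1 = n by lia.
have -> : nth 0%R (pr T) j.+1 = mu j.+1 by rewrite e nth_pr_last mun.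
exact: Sj.
Qed.

Lemma fan_levels j :
  [/\ decreasing (lev (mu j)), interlaced (lev (mu j)) (lev (mu j.+1)) &
      j <= n -> parity_levels j (lev (mu j))].
Proof.
split; first exact: lev_decreasing.
- apply: lev_near; have [jn|nj] := ltnP j n; first exact/unit_step_near/muS.
  (* Beyond the tuple [nth] returns its default 0, so the infinite walk stays empty from position
     [n] on. *)
  have muz i : n <= i -> mu i = 0%R.
    rewrite leq_eqVlt => /orP[/eqP <- //|ni].
    by rewrite /mu nth_default ?size_tuple.
  by rewrite !muz ?leqW // => k; split.
- by move=> jn; apply/lev_parity/fan_parity.
Qed.

End Fan.

(** * The walk of a fan and of its promotion *)

Definition fan_walk T := minwalk (fun j => lev (nth 0%R T j)).

Lemma fan_walk_walk T : is_fan T -> walk (fan_walk T).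
Proof.
move=> Tf; apply: minwalk_walk => [t|j|j].
- by case: ((is_fanP T).1 Tf) => -> *; rewrite lev_zero.
- by case: (fan_levels Tf j).
- by case: (fan_levels Tf j).
Qed.

Lemma fan_walk_vanishes T : is_fan T -> vanishes_from n (fan_walk T).
Proof.
move=> Tf j t; rewrite leq_eqVlt => /orP[/eqP <-|nj] /=.
  by case: ((is_fanP T).1 Tf) => _ -> *; rewrite lev_zero.
by rewrite nth_default ?size_tuple // lev_zero.
Qed.

Section PromotionStep.

Variable T : n.+1.-tuple 'rV[int]_r.
Hypotheses (Tf : is_fan T) (n_gt0 : 0 < n).

Lemma pr_interlaced j : j < n ->
  interlaced (lev (nth 0%R (pr T) j)) (lev (nth 0%R T j.+1)).
Proof.
by move=> jn; have [_ S] := pr_unit_step Tf jn; apply/lev_near/unit_step_near.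
Qed.

Lemma promotion_levels_fan j : j.+1 < n ->
  promotion_levels j.+1 (lev (nth 0%R T j.+1)) (lev (nth 0%R T j.+2))
    (lev (nth 0%R (pr T) j)) (lev (nth 0%R (pr T) j.+1)).
Proof.
move=> jn; have jn' := ltnW jn; rewrite (pr_rec Tf jn).
have [_ _ TP TS] := (is_fanP T).1 Tf.
have [Pj Sj] := pr_unit_step Tf jn'.
apply: dom_promotion_levels => //.
- exact: TS.
- exact: unit_stepC.
- exact: fan_parity.
Qed.

Lemma fan_walk_removes_column :
  removes_column n.-1 (fan_walk (pr T)) (del (fan_walk T)).
Proof.
have Pf := pr_fan Tf; have Tw := fan_walk_walk Tf; have Pw := fan_walk_walk Pf.
have L := fan_levels Tf; have L' := fan_levels Pf.
apply: promotion_removes_column => //.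
- exact: Tw.1.
- exact: Pw.1.
- by move=> j; case: (L' j).
- by move=> j; case: (L j).
- by move=> j; case: (L' j).
- exact: pr_interlaced.
- by move=> j; case: (L j).
- by move=> j; case: (L' j).
exact: promotion_levels_fan.
Qed.

Lemma fan_walk_entry j : j.+1 < n -> del_entry (fan_walk T) j =
  num_neg (nth 0%R (pr T) j + nth 0%R T j.+2 - nth 0%R T j.+1)%R.
Proof.
move=> jn; have jn' := ltnW jn.
have [_ _ TP TS] := (is_fanP T).1 Tf.
have [Pj Sj] := pr_unit_step Tf jn'.
rewrite num_neg_levels //; [|exact: TS|exact: unit_stepC].
have Pf := pr_fan Tf; have Tw := fan_walk_walk Tf; have Pw := fan_walk_walk Pf.
have L := fan_levels Tf; have L' := fan_levels Pf.
apply: (@del_entry_promotion n (fun i => lev (nth 0%R T i))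
  (fun i => lev (nth 0%R (pr T) i))) => //.
- exact: Tw.1.
- exact: Pw.1.
- by move=> i; case: (L i).
- by move=> i; case: (L' i).
- exact: pr_interlaced.
- by move=> i; case: (L i).
- by move=> i; case: (L' i).
- exact: promotion_levels_fan.
Qed.

End PromotionStep.

(** * Iterated deletion and the rows of the matrix *)

Lemma iter_del_start s T : (iter s del (fan_walk T)).1 0 0 = r.
Proof. by elim: s => [|s IH]; [exact: lev_0 | exact: IH]. Qed.

Lemma iter_pr_fan T s : is_fan T -> is_fan (iter s (@pr r n) T).
Proof. by move=> Tf; elim: s => //= s; exact: pr_fan. Qed.

(** Each deletion applied to both walks costs one position, since a deleted shape lies under the
    next position. *)
Lemma iter_del_removes_column s T : is_fan T -> s < n ->
  removes_column (n.-1 - s) (iter s del (fan_walk (pr T)))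
    (iter s.+1 del (fan_walk T)).
Proof.
move=> Tf; elim: s => [|s IH] sn.
  by rewrite subn0; apply: fan_walk_removes_column => //; lia.
have Pf := pr_fan Tf.
apply: (@del_removes_column (iter s del (fan_walk (pr T)))
  (iter s.+1 del (fan_walk T))).
- exact/iter_del_walk/fan_walk_walk.
- exact/iter_del_walk/fan_walk_walk.
have -> : (n.-1 - s.+1).+1 = n.-1 - s by lia.
by apply: IH; lia.
Qed.

(** Trading one deletion for one promotion removes only an outermost column, which leaves the
    entries in this range unchanged; this is repeated [s] times. *)
Lemma iter_del_entry s T j : is_fan T -> s + j.+1 < n ->
  del_entry (iter s del (fan_walk T)) j =
  del_entry (fan_walk (iter s (@pr r n) T)) j.
Proof.
elim: s T => [|s IH] T Tf sj //; have Pf := pr_fan Tf.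
rewrite [iter s.+1 (@pr r n) T]iterSr -IH //; last by lia.
apply: esym; apply: (@del_entry_removes_column _ _ (n.-1 - s).-1); last by lia.
- exact/iter_del_walk/fan_walk_walk.
- exact/iter_del_walk/fan_walk_walk.
by rewrite prednK; [apply: iter_del_removes_column => //|]; lia.
Qed.

Lemma iter_del_vanishes s T : is_fan T ->
  vanishes_from (n - s) (iter s del (fan_walk T)).
Proof.
move=> Tf; elim: s => [|s IH]; first by rewrite subn0; exact: fan_walk_vanishes.
have Tw := iter_del_walk s (fan_walk_walk Tf).
have [sn|ns] := ltnP s n.
  apply: del_vanishes => //.
  by have -> : (n - s.+1).+1 = n - s by lia.
have e : n - s.+1 = n - s by lia.
by rewrite e; apply: del_vanishes => // j t nj; apply: IH; lia.
Qed.

Lemma del_entry_vanishes N V j : vanishes_from N V -> N <= j.+1 ->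
  del_entry V j = 0.
Proof. by move=> VN Nj; rewrite /del_entry (VN j.+1 0 Nj). Qed.

Lemma M_F_entry T (i j : 'I_n) : is_fan T -> i < j ->
  M_F T i j = del_entry (iter i del (fan_walk T)) (j - i.+1).
Proof.
move=> Tf ij; have jn := ltn_ord j; have e : i + (j - i.+1).+1 = j by lia.
rewrite iter_del_entry //; last by rewrite e.
rewrite fan_walk_entry; [|exact: iter_pr_fan|by lia|by lia].
rewrite mxE ifF; last by apply/eqP => ij'; move: ij; rewrite ij'; lia.
(* Above the diagonal there is no wraparound: [d] is [j - i]. *)
have -> : (j + n - i) %% n = (j - i.+1).+1.
  have -> : j + n - i = (j - i.+1).+1 + n by lia.
  by rewrite modnDr modn_small //; lia.
by [].
Qed.

(** Within the triangle these are entries of the matrices; outside it both walks have already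
    vanished, so both sides are 0. *)
Lemma eq_M_F_entry F G i j : is_fan F -> is_fan G -> M_F F = M_F G ->
  del_entry (iter i del (fan_walk F)) j = del_entry (iter i del (fan_walk G)) j.
Proof.
move=> Ff Gf eqM; have [ijn|nij] := ltnP (i + j.+1) n; last first.
  rewrite (del_entry_vanishes (iter_del_vanishes (s := i) Ff)); last by lia.
  by rewrite (del_entry_vanishes (iter_del_vanishes (s := i) Gf)) //; lia.
have i_n : i < n by lia.
pose i' := Ordinal i_n; pose j' := Ordinal ijn.
have ij' : i' < j' by rewrite /=; lia.
have -> : j = j' - i'.+1 by rewrite /=; lia.
by rewrite -[i in iter i]/(nat_of_ord i') -!M_F_entry // eqM.
Qed.

End FanLevels.

Theorem corollary4p6 (r n : nat) (hr : (0 < r)%N) (hn : (0 < n)%N) :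
  {in @is_fan r n &, injective (@M_F r n)}.
Proof.
move=> F G Ff Gf eqM.
have {}Ff : is_fan F := Ff; have {}Gf : is_fan G := Gf.
have [Fw Gw] := (fan_walk_walk Ff, fan_walk_walk Gf).
(* After [n] deletions both walks are empty; [s] counts the rows put back, each by [del_inj]. *)
have eqW s : s <= n ->
    eqwalk (iter (n - s) del (fan_walk F)) (iter (n - s) del (fan_walk G)).
  elim: s => [|s IH] sn.
    rewrite subn0; apply: eqwalk_vanishing.
    - exact: iter_del_walk.
    - exact: iter_del_walk.
    - by rewrite !iter_del_start.
    - by have := iter_del_vanishes (s := n) Ff; rewrite subnn.
    - by have := iter_del_vanishes (s := n) Gf; rewrite subnn.
  have {}IH := IH (ltnW sn); have e : n - s = (n - s.+1).+1 by lia.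
  rewrite e in IH; apply: (@del_inj n) => //.
  - exact: iter_del_walk.
  - exact: iter_del_walk.
  - by rewrite !iter_del_start.
  - by move=> j t nj; apply: (iter_del_vanishes Ff); lia.
  - by move=> j t nj; apply: (iter_del_vanishes Gf); lia.
  - by move=> j; apply: eq_M_F_entry.
have eqF j : nth 0%R F j = nth 0%R G j.
  have [_ _ FP _] := (is_fanP F).1 Ff; have [_ _ GP _] := (is_fanP G).1 Gf.
  apply: lev_inj => // t; have := eqW n (leqnn n) j t.
  by rewrite subnn => -[].
apply: val_inj; apply: (@eq_from_nth _ 0%R); first by rewrite !size_tuple.
by move=> j _; exact: eqF.
Qed.
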